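(* Let $F=Z+W\mathbf j\in L^1(\mathbb T^d;\mathbb H^{s\times t})$ with $Z,W:\mathbb T^d\to\mathbb C_{\mathbf i}^{s\times t}$. Define the complex symbols $$G_{\mathrm L}(\boldsymbol\theta)=\begin{pmatrix}Z(\boldsymbol\theta)&W(\boldsymbol\theta)\\-\overline{W(-\boldsymbol\theta)}&\overline{Z(-\boldsymbol\theta)}\end{pmatrix},\qquad G_{\mathrm R}(\boldsymbol\theta)=\begin{pmatrix}Z(\boldsymbol\theta)&W(-\boldsymbol\theta)\\-\overline{W(\boldsymbol\theta)}&\overline{Z(-\boldsymbol\theta)}\end{pmatrix}.$$ Then for every $\boldsymbol n\in\mathbb N^d$, $\Phi(T^{(L)}_{\boldsymbol n}(F))=T_{\boldsymbol n}(G_{\mathrm L})$ and $\Phi(T^{(R)}_{\boldsymbol n}(F))=T_{\boldsymbol n}(G_{\mathrm R})$.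
   Context: $\mathbb H$ is the quaternion algebra with units $\mathbf i,\mathbf j,\mathbf k=\mathbf i\mathbf j$; $\mathbb C_{\mathbf i}=\operatorname{span}_{\mathbb R}\{1,\mathbf i\}\cong\mathbb C$, bar = complex conjugation. For $A=Z+W\mathbf j\in\mathbb H^{s\times t}$, $\Phi(A)=\begin{bmatrix}Z&W\\-\overline W&\overline Z\end{bmatrix}\in\mathbb C^{2s\times2t}$; for an $s\times t$-block matrix $A=[A_{\alpha\beta}]$, $\Phi(A)=[\Phi(A_{\alpha\beta})]_{\alpha,\beta}$ (applied blockwise). $\mathbb T^d=[-\pi,\pi)^d$. Left/right Fourier coefficients: $\widehat F^{(L)}(\boldsymbol k)=(2\pi)^{-d}\int e^{-\mathbf i\langle\boldsymbol k,\boldsymbol\theta\rangle}F(\boldsymbol\theta)d\boldsymbol\theta$, $\widehat F^{(R)}(\boldsymbol k)=(2\pi)^{-d}\int F(\boldsymbol\theta)e^{-\mathbf i\langle\boldsymbol k,\boldsymbol\theta\rangle}d\boldsymbol\theta$. With $\Lambda_{\boldsymbol n}=\prod_\ell\{0,\dots,n_\ell-1\}$ (lexicographic), $T^{(\tau)}_{\boldsymbol n}(F)=[\widehat F^{(\tau)}(\alpha-\beta)]_{\alpha,\beta\in\Lambda_{\boldsymbol n}}$. For complex $G:\mathbb T^d\to\mathbb C^{2s\times2t}$, $T_{\boldsymbol n}(G)=[\widehat G(\alpha-\beta)]_{\alpha,\beta\in\Lambda_{\boldsymbol n}}$ with $\widehat G(\boldsymbol k)=(2\pi)^{-d}\int G(\boldsymbol\theta)e^{-\mathbf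 i\langle\boldsymbol k,\boldsymbol\theta\rangle}d\boldsymbol\theta$. *)

(* Defs.v *)
From HB Require Import structures.
From mathcomp Require Import all_boot all_order all_algebra.
From mathcomp Require Import all_classical all_reals all_analysis.
From mathcomp Require Import complex.
Import Order.TTheory GRing.Theory Num.Theory.
Set Implicit Arguments.
Unset Strict Implicit.
Unset Printing Implicit Defensive.
Local Open Scope classical_set_scope.
Local Open Scope ring_scope.

(* d-dimensional Lebesgue measure, built as an iterated product measure     *)
Record msp (R : realType) := MSp {
  msp_disp : measure_display;
  msp_car : measurableType msp_disp;
  msp_mu : {sigma_finite_measure set msp_car -> \bar R} }.
Arguments MSp {R msp_disp msp_car}.
Arguments msp_car {R}.
Arguments msp_mu {R}.
Definition unit_mu (R : realType) : {sigma_finite_measure set unit -> \bar R} := @dirac _ unit tt R.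
Definition leb (R : realType) : {sigma_finite_measure set (measurableTypeR R) -> \bar R} :=
  @lebesgue_measure R.
Definition pm (R : realType) (S : msp R) :
  set (measurableTypeR R * msp_car S)%type -> \bar R := (leb R \x msp_mu S)%E.
HB.instance Definition _ (R : realType) (S : msp R) :=
  Measure.copy (@pm R S) (leb R \x msp_mu S)%E.
Lemma pm_sigma_finite (R : realType) (S : msp R) : sigma_finite setT (@pm R S).
Proof.
rewrite /pm.
have /sigma_finiteP[F [TF ndF Foo]] := sigma_finiteT (leb R).
have /sigma_finiteP[G [TG ndG Goo]] := sigma_finiteT (msp_mu S).
exists (fun n => F n `*` G n).
 rewrite -setXTT TF TG predeqE => -[x y]; split.
    move=> [/= [n _ Fnx] [k _ Gky]]; exists (maxn n k) => //; split.
    - by move: x Fnx; exact/subsetPset/ndF/leq_maxl.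
    - by move: y Gky; exact/subsetPset/ndG/leq_maxr.
  by move=> [n _ []/= ? ?]; split; exists n.
move=> k; have [? ?] := Foo k; have [? ?] := Goo k.
split; first exact: measurableX.
by rewrite product_measure1E// lte_mul_pinfty// ge0_fin_numE.
Qed.
HB.instance Definition _ (R : realType) (S : msp R) :=
  Measure_isSigmaFinite.Build _ _ _ (@pm R S) (@pm_sigma_finite R S).

Fixpoint Rn_space (R : realType) (d : nat) : msp R :=
  match d with
  | 0 => MSp (unit_mu R)
  | d'.+1 => MSp (@pm R (Rn_space R d'))
  end.

Fixpoint coords (R : realType) (d : nat) : msp_car (Rn_space R d) -> nat -> R :=
  match d return msp_car (Rn_space R d) -> nat -> R with
  | 0 => fun _ _ => 0
  | d'.+1 => fun p i => if i is i'.+1 then coords p.2 i' else p.1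
  end.

Definition pt (R : realType) (d : nat) (p : msp_car (Rn_space R d)) : 'I_d -> R :=
  fun l => coords p (nat_of_ord l).

Definition torus (R : realType) (d : nat) : set (msp_car (Rn_space R d)) :=
  [set p | forall l : 'I_d, - pi <= pt p l < pi].

Definition tint (R : realType) (d : nat) (f : ('I_d -> R) -> R) : R :=
  Rintegral (msp_mu (Rn_space R d)) (@torus R d) (fun p => f (pt p)).

Definition tintegrable (R : realType) (d : nat) (f : ('I_d -> R) -> R) : Prop :=
  (msp_mu (Rn_space R d)).-integrable (@torus R d) (fun p => (f (pt p))%:E).

(* Quaternions  q = a + b i + c j + d k  with Hamilton's product            *)
Record quat (R : Type) := Quat { q0 : R; q1 : R; q2 : R; q3 : R }.
Arguments Quat {R}.
Arguments q0 {R}. Arguments q1 {R}. Arguments q2 {R}. Arguments q3 {R}.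

Definition qadd (R : realType) (p q : quat R) : quat R :=
  Quat (q0 p + q0 q) (q1 p + q1 q) (q2 p + q2 q) (q3 p + q3 q).

Definition qmul (R : realType) (p q : quat R) : quat R :=
  Quat (q0 p * q0 q - q1 p * q1 q - q2 p * q2 q - q3 p * q3 q)
       (q0 p * q1 q + q1 p * q0 q + q2 p * q3 q - q3 p * q2 q)
       (q0 p * q2 q - q1 p * q3 q + q2 p * q0 q + q3 p * q1 q)
       (q0 p * q3 q + q1 p * q2 q - q2 p * q1 q + q3 p * q0 q).

Definition qj (R : realType) : quat R := Quat 0 0 1 0.

Definition c2q (R : realType) (z : R[i]) : quat R := Quat (complex.Re z) (complex.Im z) 0 0.

Definition qscale (R : realType) (c : R) (q : quat R) : quat R :=
  Quat (c * q0 q) (c * q1 q) (c * q2 q) (c * q3 q).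

Definition qint (R : realType) (d : nat) (f : ('I_d -> R) -> quat R) : quat R :=
  Quat (tint (fun x => q0 (f x))) (tint (fun x => q1 (f x)))
       (tint (fun x => q2 (f x))) (tint (fun x => q3 (f x))).

Definition cint (R : realType) (d : nat) (f : ('I_d -> R) -> R[i]) : R[i] :=
  Complex (tint (fun x => complex.Re (f x))) (tint (fun x => complex.Im (f x))).

Definition dotk (R : realType) (d : nat) (k : 'I_d -> int) (th : 'I_d -> R) : R :=
  \sum_(l < d) (k l)%:~R * th l.

Definition cexpi (R : realType) (phi : R) : R[i] := Complex (cos phi) (sin phi).
Definition qexpi (R : realType) (phi : R) : quat R := c2q (cexpi phi).

Definition nrm (R : realType) (d : nat) : R := ((2 * pi) ^+ d)^-1.

Definition FcoefL (R : realType) (d s t : nat)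
  (F : ('I_d -> R) -> 'M[quat R]_(s, t)) (k : 'I_d -> int) : 'M[quat R]_(s, t) :=
  \matrix_(a < s, b < t)
    qscale (nrm R d) (qint (fun th => qmul (qexpi (- dotk k th)) (F th a b))).

Definition FcoefR (R : realType) (d s t : nat)
  (F : ('I_d -> R) -> 'M[quat R]_(s, t)) (k : 'I_d -> int) : 'M[quat R]_(s, t) :=
  \matrix_(a < s, b < t)
    qscale (nrm R d) (qint (fun th => qmul (F th a b) (qexpi (- dotk k th)))).

Definition Fcoef (R : realType) (d p q : nat)
  (G : ('I_d -> R) -> 'M[R[i]]_(p, q)) (k : 'I_d -> int) : 'M[R[i]]_(p, q) :=
  \matrix_(a < p, b < q)
    (real_complex R (nrm R d) * cint (fun th => G th a b * cexpi (- dotk k th))).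

Definition Lam (d : nat) (n : 'I_d -> nat) : Type := forall l : 'I_d, 'I_(n l).

Definition mdiff (d : nat) (n : 'I_d -> nat) (al be : Lam n) : 'I_d -> int :=
  fun l => (nat_of_ord (al l))%:Z - (nat_of_ord (be l))%:Z.

Definition blockmx (d : nat) (n : 'I_d -> nat) (X : Type) := Lam n -> Lam n -> X.

Definition ToepL (R : realType) (d s t : nat) (n : 'I_d -> nat)
  (F : ('I_d -> R) -> 'M[quat R]_(s, t)) : blockmx n 'M[quat R]_(s, t) :=
  fun al be => FcoefL F (mdiff al be).

Definition ToepR (R : realType) (d s t : nat) (n : 'I_d -> nat)
  (F : ('I_d -> R) -> 'M[quat R]_(s, t)) : blockmx n 'M[quat R]_(s, t) :=
  fun al be => FcoefR F (mdiff al be).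

Definition Toep (R : realType) (d p q : nat) (n : 'I_d -> nat)
  (G : ('I_d -> R) -> 'M[R[i]]_(p, q)) : blockmx n 'M[R[i]]_(p, q) :=
  fun al be => Fcoef G (mdiff al be).

Definition qZ (R : realType) (s t : nat) (A : 'M[quat R]_(s, t)) : 'M[R[i]]_(s, t) :=
  \matrix_(a < s, b < t) Complex (q0 (A a b)) (q1 (A a b)).
Definition qW (R : realType) (s t : nat) (A : 'M[quat R]_(s, t)) : 'M[R[i]]_(s, t) :=
  \matrix_(a < s, b < t) Complex (q2 (A a b)) (q3 (A a b)).
Definition cconj (R : realType) (s t : nat) (M : 'M[R[i]]_(s, t)) : 'M[R[i]]_(s, t) :=
  map_mx (fun z => z^*) M.

Definition Phi (R : realType) (s t : nat) (A : 'M[quat R]_(s, t)) : 'M[R[i]]_(s + s, t + t) :=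
  block_mx (qZ A) (qW A) (- cconj (qW A)) (cconj (qZ A)).

Definition blockPhi (R : realType) (d s t : nat) (n : 'I_d -> nat)
  (T : blockmx n 'M[quat R]_(s, t)) : blockmx n 'M[R[i]]_(s + s, t + t) :=
  fun al be => Phi (T al be).

Definition negv (R : realType) (d : nat) (th : 'I_d -> R) : 'I_d -> R := fun l => - th l.

Definition GL (R : realType) (d s t : nat) (Z W : ('I_d -> R) -> 'M[R[i]]_(s, t))
  (th : 'I_d -> R) : 'M[R[i]]_(s + s, t + t) :=
  block_mx (Z th) (W th) (- cconj (W (negv th))) (cconj (Z (negv th))).

Definition GR (R : realType) (d s t : nat) (Z W : ('I_d -> R) -> 'M[R[i]]_(s, t))
  (th : 'I_d -> R) : 'M[R[i]]_(s + s, t + t) :=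
  block_mx (Z th) (W (negv th)) (- cconj (W th)) (cconj (Z (negv th))).

Arguments ToepL {R d s t} n F.
Arguments ToepR {R d s t} n F.
Arguments Toep {R d p q} n G.
Arguments blockPhi {R d s t n} T.

(* Main.v *)
(* Write F = Z + W j.  The character e = exp(-i<k,θ>) lies in C_i, so
   e (Z + W j) = e Z + (e W) j, while j e = ē j gives (Z + W j) e = Z e + (W ē) j.
   Hence the blocks of Φ applied to a left or right Fourier coefficient of F are
   Fourier coefficients of Z, W and their conjugates, at k or at -k.  Conjugating
   a Fourier coefficient and reflecting the symbol by θ ↦ -θ both replace k by -k;
   the reflection preserves Lebesgue measure and maps [-π,π)^d onto itself up to
   the null set where some coordinate equals ±π.  Combining these gives exactly
   the Fourier coefficients of G_L and G_R.
   Each entry is a single integral, and the integral identities used (reflection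
   invariance, removal of a null set, ∫ -f = -∫ f) hold for arbitrary integrands. *)

Require Import Defs.
From HB Require Import structures.
From mathcomp Require Import all_boot all_order all_algebra.
From mathcomp Require Import all_classical all_reals all_analysis.
From mathcomp Require Import complex.
From mathcomp Require Import ring.
Import Order.TTheory GRing.Theory Num.Theory.
Import HBNNSimple.
Local Open Scope classical_set_scope.
Local Open Scope ring_scope.

Section integral_involution.
Context d (T : measurableType d) (R : realType) (mu : {measure set T -> \bar R}).
Variable phi : T -> T.
Hypotheses (mphi : measurable_fun setT phi) (phiK : involutive phi)
  (mu_phi : forall A, measurable A -> mu (phi @^-1` A) = mu A).

Let measurable_preimage A : measurable A -> measurable (phi @^-1` A).
Proof. by move=> mA; rewrite -[_ @^-1` _]setTI; exact: mphi. Qed.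

Section comp_nnsfun.
Variable h : {nnsfun T >-> R}.

Definition comp_phi : T -> R := h \o phi.

Let measurable_comp_phi : measurable_fun setT comp_phi.
Proof.
move=> _ Y mY; rewrite setTI.
exact: measurable_preimage (measurable_funPTI h mY).
Qed.

HB.instance Definition _ :=
  isMeasurableFun.Build _ _ T R comp_phi measurable_comp_phi.

Let finite_range_comp_phi : finite_set (range comp_phi).
Proof.
by apply: sub_finite_set (fimfunP h) => _ [x _ <-]; exists (phi x).
Qed.

HB.instance Definition _ := FiniteImage.Build T R comp_phi finite_range_comp_phi.

Let comp_phi_ge0 x : 0 <= comp_phi x. Proof. exact: fun_ge0. Qed.

HB.instance Definition _ := isNonNegFun.Build T R comp_phi comp_phi_ge0.

Lemma sintegral_comp_phi : sintegral mu comp_phi = sintegral mu h.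
Proof.
apply: eq_fsbigr => r _; congr (_ * _)%E.
by rewrite -[comp_phi @^-1` _]/(phi @^-1` (h @^-1` [set r])) mu_phi.
Qed.

End comp_nnsfun.

Let sup_sintegral_le (g1 g2 : T -> \bar R) : (forall x, g1 x = g2 (phi x)) ->
  (ereal_sup [set sintegral mu h |
      h in [set h : {nnsfun T >-> R} | forall x, (h x)%:E <= g1 x]]
   <= ereal_sup [set sintegral mu h |
      h in [set h : {nnsfun T >-> R} | forall x, (h x)%:E <= g2 x]])%E.
Proof.
move=> g12; apply: ge_ereal_sup => _ [h hg1 <-]; apply: ereal_sup_ubound.
exists (comp_phi h : {nnsfun T >-> R}); last exact: sintegral_comp_phi.
by move=> x; have := hg1 (phi x); rewrite g12 phiK.
Qed.

(* No measurability of [f] is needed: the integral is a supremum over simple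
   functions, and [h |-> h \o phi] maps those below [f \o phi] onto those below [f]. *)
Lemma integral_involution (D : set T) (f : T -> \bar R) : phi @^-1` D = D ->
  (\int[mu]_(x in D) f (phi x) = \int[mu]_(x in D) f x)%E.
Proof.
move=> phiD.
have ge0_involution (g : T -> \bar R) : (forall x, 0 <= g x)%E ->
    (\int[mu]_(x in D) g (phi x) = \int[mu]_(x in D) g x)%E.
  move=> g0; rewrite !ge0_integralE//.
  have patch_phi x : ((g \o phi) \_ D) x = (g \_ D) (phi x).
    by rewrite /patch -[in x \in D]phiD.
  by apply/eqP; rewrite eq_le !sup_sintegral_le// => x; rewrite ?patch_phi ?phiK.
rewrite integralE [RHS]integralE funepos_comp funeneg_comp.
by rewrite !ge0_involution.
Qed.

End integral_involution.

Section integral_setD_null.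
Context {d} {T : measurableType d} {R : realType} {mu : {measure set T -> \bar R}}.
Variable N : set T.
Hypotheses (mN : measurable N) (N0 : mu N = 0%E).

Let mNC : measurable (~` N). Proof. exact: measurableC. Qed.

Let sintegral_restrict (h : {nnsfun T >-> R}) :
  sintegral mu (mul_nnsfun h (indic_nnsfun R mNC)) = sintegral mu h.
Proof.
rewrite -!integralT_nnsfun [RHS](ge0_negligible_integral (D := setT) mN)//=.
- rewrite [RHS]integral_mkcond; apply: eq_integral => x _.
  rewrite /patch measurable_realfun.mindicE in_setD in_setC in_setT.
  by case: (x \in N); rewrite /= ?mulr0 ?mulr1.
- exact/measurable_realfun.measurable_EFinP/measurable_funPT.
- by move=> x _; rewrite lee_fin.
Qed.

(* Again no measurability of [f] is needed: multiplying a simple function by the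
   indicator of [~` N] does not change its integral. *)
Lemma integral_setD_null (D : set T) (f : T -> \bar R) :
  (\int[mu]_(x in D) f x = \int[mu]_(x in D `\` N) f x)%E.
Proof.
have ge0_setD (g : T -> \bar R) : (forall x, 0 <= g x)%E ->
    (\int[mu]_(x in D) g x = \int[mu]_(x in D `\` N) g x)%E.
  move=> g0; rewrite !ge0_integralE//; apply/eqP; rewrite eq_le; apply/andP; split.
    apply: ge_ereal_sup => _ [h hg <-]; apply: ereal_sup_ubound.
    exists (mul_nnsfun h (indic_nnsfun R mNC)); last exact: sintegral_restrict.
    move=> x /=; rewrite measurable_realfun.mindicE /patch in_setD in_setC.
    have := hg x; rewrite /patch.
    by case: (boolP (x \in N)) => xN /=; rewrite ?andbF ?andbT ?mulr0 ?mulr1.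
  apply: ge_ereal_sup => _ [h hg <-]; apply: ereal_sup_ubound.
  exists h => // x; apply: le_trans (hg x) _; rewrite /patch.
  case: ifPn => [|_]; last by case: ifP.
  by rewrite inE => -[xD _]; rewrite ifT// inE.
by rewrite integralE [RHS]integralE !ge0_setD.
Qed.

End integral_setD_null.

(* No integrability is needed: when both parts of [f] have infinite integral,
   both sides are the junk value [0]. *)
Lemma RintegralN d (T : measurableType d) (R : realType)
    (mu : {measure set T -> \bar R}) (D : set T) (f : T -> R) :
  Rintegral mu D (fun x => - f x) = - Rintegral mu D f.
Proof.
rewrite /Rintegral (_ : (fun x => (- f x)%:E) = (\- (EFin \o f))%E); last first.
  by apply/funext => x; rewrite EFinN.
rewrite integralE funeposN funenegN [in RHS]integralE.
have := integral_ge0 mu (D := D) (fun x _ => funepos_ge0 (EFin \o f) x).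
have := integral_ge0 mu (D := D) (fun x _ => funeneg_ge0 (EFin \o f) x).
by case: (integral _ _ _) => [a||]; case: (integral _ _ _) => [b||] //= _ _;
  rewrite ?oppr0 // opprB.
Qed.

Fixpoint Rn_opp (R : realType) (d : nat) :
    msp_car (Rn_space R d) -> msp_car (Rn_space R d) :=
  match d return msp_car (Rn_space R d) -> msp_car (Rn_space R d) with
  | 0 => id
  | d'.+1 => fun p => (- p.1, @Rn_opp R d' p.2)
  end.
Arguments Rn_opp {R d}.

Section reflection.
Variable R : realType.

Let measurable_oppR : measurable_fun setT (-%R : measurableTypeR R -> measurableTypeR R).
Proof. exact: measurable_realfun.oppr_measurable. Qed.

Lemma coords_Rn_opp d (p : msp_car (Rn_space R d)) i :
  coords (Rn_opp p) i = - coords p i.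
Proof.
elim: d p i => [|d IH] p [|i] /=; rewrite ?oppr0 //; exact: IH.
Qed.

Lemma pt_Rn_opp d (p : msp_car (Rn_space R d)) : pt (Rn_opp p) = negv (pt p).
Proof. by apply/funext => l; rewrite /pt coords_Rn_opp. Qed.

Lemma Rn_oppK d : involutive (@Rn_opp R d).
Proof. by elim: d => [|d IH] //= [a b] /=; rewrite opprK IH. Qed.

Lemma measurable_Rn_opp d : measurable_fun setT (@Rn_opp R d).
Proof.
elim: d => [|d IH] /=; first exact: measurable_id.
apply/measurable_fun_pairP; split.
  exact: measurableT_comp measurable_oppR measurable_fst.
exact: measurableT_comp IH measurable_snd.
Qed.

Lemma measure_Rn_opp d (A : set (msp_car (Rn_space R d))) : measurable A ->
  msp_mu (Rn_space R d) (Rn_opp @^-1` A) = msp_mu (Rn_space R d) A.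
Proof.
elim: d A => [|d IH] A mA //=.
rewrite /pm /product_measure1 /=.
transitivity (\int[leb R]_x msp_mu (Rn_space R d) (xsection A (- x)%R))%E.
  by apply: eq_integral => x _; rewrite -[RHS]IH//; exact: measurable_xsection.
exact: (@integral_involution _ _ _ (leb R) _ measurable_oppR opprK lebesgue_measureN
  setT (fun x => msp_mu (Rn_space R d) (xsection A x)) (preimage_setT _)).
Qed.

Definition torus_face d (l : nat) : set (msp_car (Rn_space R d)) :=
  [set p | coords p l = - pi].

Lemma torus_face_dim0 l : torus_face 0 l = set0.
Proof.
apply/seteqP; split => p //= /esym/eqP.
by rewrite oppr_eq0 (gt_eqF (@pi_gt0 R)).
Qed.

Lemma torus_face0 d : torus_face d.+1 0 = [set - pi] `*` setT.
Proof.
by apply/seteqP; split => -[a b]; rewrite /torus_face /setX /=; [move=> ->|case=> ->].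
Qed.

Lemma torus_faceS d l : torus_face d.+1 l.+1 = setT `*` torus_face d l.
Proof.
by apply/seteqP; split => -[a b]; rewrite /torus_face /setX /=; [move=> ->|case=> _ ->].
Qed.

Lemma measurable_torus_face d l : measurable (torus_face d l).
Proof.
elim: d l => [|d IH] [|l]; rewrite ?torus_face_dim0 ?torus_face0 ?torus_faceS //;
  exact: measurableX.
Qed.

Lemma torus_face_null d l : msp_mu (Rn_space R d) (torus_face d l) = 0%E.
Proof.
elim: d l => [|d IH] [|l]; rewrite ?torus_face_dim0 ?measure0 //=.
  rewrite torus_face0 /pm product_measure1E//.
  by rewrite [X in (X * _)%E](_ : _ = 0%E) ?mul0e//; exact: lebesgue_measure_set1.
by rewrite torus_faceS /pm product_measure1E ?IH ?mule0//; exact: measurable_torus_face.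
Qed.

Definition torus_boundary d : set (msp_car (Rn_space R d)) := \bigcup_l torus_face d l.

Lemma measurable_torus_boundary d : measurable (torus_boundary d).
Proof. by apply: bigcupT_measurable => l; exact: measurable_torus_face. Qed.

Lemma torus_boundary_null d : msp_mu (Rn_space R d) (torus_boundary d) = 0%E.
Proof.
apply: measure_negligible; first exact: measurable_torus_boundary.
apply: negligible_bigcup => l; exists (torus_face d l).
by split; [exact: measurable_torus_face|exact: torus_face_null|].
Qed.

Definition open_cube d : set (msp_car (Rn_space R d)) :=
  [set p | forall l : 'I_d, - pi < pt p l < pi].

Lemma coords_ge_dim d (p : msp_car (Rn_space R d)) i : (d <= i)%N -> coords p i = 0.
Proof. by elim: d p i => [|d IH] p [|i] //= /IH. Qed.

Lemma torus_setD_boundary d : @torus R d `\` torus_boundary d = open_cube d.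
Proof.
apply/seteqP; split => p /=.
  move=> [Tp Np] l; have /andP[pi_le lt_pi] := Tp l; rewrite lt_pi andbT.
  rewrite lt_neqAle pi_le andbT; apply/eqP => pl; apply: Np.
  by exists (nat_of_ord l).
move=> Op; split => [l|[l _]]; first by have /andP[+ ->] := Op l => /ltW ->.
rewrite /torus_face /=; have [ld|dl] := ltnP l d.
  by have /andP[+ _] := Op (Ordinal ld); rewrite /pt /= => /gt_eqF/eqP.
by rewrite coords_ge_dim// => /esym/eqP; rewrite oppr_eq0 (gt_eqF (@pi_gt0 R)).
Qed.

Lemma Rn_opp_open_cube d : Rn_opp @^-1` open_cube d = open_cube d.
Proof.
apply/seteqP; split => p /= Op l; have := Op l;
  by rewrite pt_Rn_opp /negv ltrN2 ltrNl andbC.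
Qed.

End reflection.

Section torus_integral.
Variables (R : realType) (d : nat).
Implicit Types f g : ('I_d -> R) -> R.

Lemma tint_ext f g : (forall th, (forall l, - pi <= th l < pi) -> f th = g th) ->
  tint f = tint g.
Proof. by move=> fg; apply: eq_Rintegral => p /[1!inE] /fg. Qed.

Lemma tintN f : tint (fun th => - f th) = - tint f.
Proof. exact: RintegralN. Qed.

Lemma tint_open_cube f :
  tint f = fine (\int[msp_mu (Rn_space R d)]_(p in open_cube R d) (f (pt p))%:E)%E.
Proof.
rewrite /tint /Rintegral.
rewrite (integral_setD_null _ (measurable_torus_boundary R d) (torus_boundary_null R d)).
by rewrite torus_setD_boundary.
Qed.

Lemma tint_negv f : tint (fun th => f (negv th)) = tint f.
Proof.
rewrite !tint_open_cube; congr fine.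
under eq_integral do rewrite -pt_Rn_opp.
exact: integral_involution (@measurable_Rn_opp R d) (@Rn_oppK R d)
  (@measure_Rn_opp R d) _ _ (Rn_opp_open_cube R d).
Qed.

Implicit Types u v : ('I_d -> R) -> R[i].

Lemma cint_ext u v : (forall th, (forall l, - pi <= th l < pi) -> u th = v th) ->
  cint u = cint v.
Proof. by move=> uv; congr Complex; apply: tint_ext => th /uv ->. Qed.

Lemma cint_conj u : cint (fun th => (u th)^*) = (cint u)^*.
Proof.
have -> : (cint u)^* =
    Complex (tint (fun th => complex.Re (u th))) (- tint (fun th => complex.Im (u th))).
  by [].
by rewrite -tintN; congr Complex; apply: tint_ext => th _; case: (u th).
Qed.

Lemma cintN u : cint (fun th => - u th) = - cint u.
Proof.
have -> : - cint u =
    Complex (- tint (fun th => complex.Re (u th))) (- tint (fun th => complex.Im (u th))).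
  by [].
by rewrite -!tintN; congr Complex; apply: tint_ext => th _; case: (u th).
Qed.

Lemma cint_negv u : cint (fun th => u (negv th)) = cint u.
Proof. by rewrite /cint !(tint_negv (fun th => _ (u th))). Qed.

End torus_integral.

Lemma negvK (R : realType) d : involutive (@negv R d).
Proof. by move=> th; apply/funext => l; rewrite /negv opprK. Qed.

Lemma dotkNl (R : realType) d (k : 'I_d -> int) (th : 'I_d -> R) :
  dotk (fun l => - k l) th = - dotk k th.
Proof. by rewrite /dotk -sumrN; apply: eq_bigr => l _; rewrite mulrNz mulNr. Qed.

Lemma dotk_negv (R : realType) d (k : 'I_d -> int) (th : 'I_d -> R) :
  dotk k (negv th) = - dotk k th.
Proof. by rewrite /dotk -sumrN; apply: eq_bigr => l _; rewrite mulrN. Qed.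

Lemma conj_cexpi (R : realType) (x : R) : (cexpi x)^* = cexpi (- x).
Proof. by rewrite /cexpi cosN sinN. Qed.

Section Fourier_coefficients.
Variables (R : realType) (d p q : nat).
Implicit Types G : ('I_d -> R) -> 'M[R[i]]_(p, q).

Let conj_real_complex (x : R) : (real_complex R x)^* = real_complex R x.
Proof. exact: conjc_real. Qed.

Lemma Fcoef_block s t (A B C D : ('I_d -> R) -> 'M[R[i]]_(s, t)) k :
  Fcoef (fun th => block_mx (A th) (B th) (C th) (D th)) k =
  block_mx (Fcoef A k) (Fcoef B k) (Fcoef C k) (Fcoef D k).
Proof.
apply/matrixP => i j; rewrite mxE.
case: (split_ordP i) => i0 ->; case: (split_ordP j) => j0 ->;
  rewrite ?block_mxEul ?block_mxEur ?block_mxEdl ?block_mxEdr mxE;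
  congr (_ * cint _); apply/funext => th;
  by rewrite ?block_mxEul ?block_mxEur ?block_mxEdl ?block_mxEdr.
Qed.

Lemma FcoefN G k : Fcoef (fun th => - G th) k = - Fcoef G k.
Proof.
apply/matrixP => a b; rewrite !mxE -mulrN -cintN.
by congr (_ * cint _); apply/funext => th; rewrite mxE mulNr.
Qed.

Lemma Fcoef_conj G k :
  Fcoef (fun th => cconj (G th)) k = cconj (Fcoef G (fun l => - k l)).
Proof.
apply/matrixP => a b; rewrite !mxE rmorphM /= conj_real_complex -cint_conj.
congr (_ * cint _); apply/funext => th.
by rewrite mxE rmorphM /= conj_cexpi dotkNl opprK.
Qed.

Lemma Fcoef_negv G k : Fcoef (fun th => G (negv th)) k = Fcoef G (fun l => - k l).
Proof.
apply/matrixP => a b; rewrite !mxE -cint_negv.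
by congr (_ * cint _); apply/funext => th; rewrite dotkNl dotk_negv opprK negvK.
Qed.

Lemma Fcoef_conj_negv G k :
  Fcoef (fun th => cconj (G (negv th))) k = cconj (Fcoef G k).
Proof.
rewrite (Fcoef_conj (fun th => G (negv th))) Fcoef_negv.
by congr (cconj (Fcoef G _)); apply/funext => l; rewrite opprK.
Qed.

End Fourier_coefficients.

Definition cayley_dickson {R : realType} (z w : R[i]) : quat R :=
  qadd (c2q z) (qmul (c2q w) (qj R)).

Section cayley_dickson.
Variable R : realType.
Implicit Types e z w : R[i].

Lemma cayley_dickson_Z z w :
  Complex (q0 (cayley_dickson z w)) (q1 (cayley_dickson z w)) = z.
Proof. by case: z w => [a b] [c e]; congr Complex => /=; ring. Qed.

Lemma cayley_dickson_W z w :
  Complex (q2 (cayley_dickson z w)) (q3 (cayley_dickson z w)) = w.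
Proof. by case: z w => [a b] [c e]; congr Complex => /=; ring. Qed.

Lemma c2q_mul_cayley_dickson e z w :
  qmul (c2q e) (cayley_dickson z w) = cayley_dickson (e * z) (e * w).
Proof. by case: e z w => [a b] [c e] [f g]; congr Quat => /=; ring. Qed.

Lemma cayley_dickson_mul_c2q e z w :
  qmul (cayley_dickson z w) (c2q e) = cayley_dickson (z * e) (w * e^*).
Proof. by case: e z w => [a b] [c e] [f g]; congr Quat => /=; ring. Qed.

End cayley_dickson.

Section quaternion_Fourier_coefficients.
Variables (R : realType) (d s t : nat) (F : ('I_d -> R) -> 'M[quat R]_(s, t)).
Variables Z W : ('I_d -> R) -> 'M[R[i]]_(s, t).
Hypothesis hF : forall th : 'I_d -> R, (forall l, - pi <= th l < pi) ->
  F th = \matrix_(a < s, b < t) cayley_dickson (Z th a b) (W th a b).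

Let qscale_qint_Z c (f : ('I_d -> R) -> quat R) :
  Complex (q0 (qscale c (qint f))) (q1 (qscale c (qint f))) =
  real_complex R c * cint (fun th => Complex (q0 (f th)) (q1 (f th))).
Proof. by congr Complex => /=; ring. Qed.

Let qscale_qint_W c (f : ('I_d -> R) -> quat R) :
  Complex (q2 (qscale c (qint f))) (q3 (qscale c (qint f))) =
  real_complex R c * cint (fun th => Complex (q2 (f th)) (q3 (f th))).
Proof. by congr Complex => /=; ring. Qed.

Lemma qZ_FcoefL k : qZ (FcoefL F k) = Fcoef Z k.
Proof.
apply/matrixP => a b; rewrite !mxE qscale_qint_Z; congr (_ * _).
apply: cint_ext => th /hF ->; rewrite mxE c2q_mul_cayley_dickson.
by rewrite cayley_dickson_Z mulrC.
Qed.

Lemma qW_FcoefL k : qW (FcoefL F k) = Fcoef W k.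
Proof.
apply/matrixP => a b; rewrite !mxE qscale_qint_W; congr (_ * _).
apply: cint_ext => th /hF ->; rewrite mxE c2q_mul_cayley_dickson.
by rewrite cayley_dickson_W mulrC.
Qed.

Lemma qZ_FcoefR k : qZ (FcoefR F k) = Fcoef Z k.
Proof.
apply/matrixP => a b; rewrite !mxE qscale_qint_Z; congr (_ * _).
apply: cint_ext => th /hF ->; rewrite mxE cayley_dickson_mul_c2q.
by rewrite cayley_dickson_Z.
Qed.

Lemma qW_FcoefR k : qW (FcoefR F k) = Fcoef W (fun l => - k l).
Proof.
apply/matrixP => a b; rewrite !mxE qscale_qint_W; congr (_ * _).
apply: cint_ext => th /hF ->; rewrite mxE cayley_dickson_mul_c2q.
by rewrite cayley_dickson_W conj_cexpi dotkNl.
Qed.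

Lemma Phi_FcoefL k : Phi (FcoefL F k) = Fcoef (GL Z W) k.
Proof.
by rewrite /Phi /GL Fcoef_block FcoefN !Fcoef_conj_negv qZ_FcoefL qW_FcoefL.
Qed.

Lemma Phi_FcoefR k : Phi (FcoefR F k) = Fcoef (GR Z W) k.
Proof.
rewrite /Phi /GR Fcoef_block FcoefN Fcoef_conj_negv Fcoef_conj Fcoef_negv.
by rewrite qZ_FcoefR qW_FcoefR.
Qed.

End quaternion_Fourier_coefficients.

Theorem mainTheorem9 (R : realType) (d s t : nat)
  (F : ('I_d -> R) -> 'M[quat R]_(s, t))
  (Z W : ('I_d -> R) -> 'M[R[i]]_(s, t))
  (* F = Z + W j on T^d *)
  (hF : forall th : 'I_d -> R, (forall l, - pi <= th l < pi) ->
          F th = \matrix_(a < s, b < t) qadd (c2q (Z th a b)) (qmul (c2q (W th a b)) (qj R)))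
  (* F in L^1(T^d; H^{s x t}) *)
  (hL1 : forall (a : 'I_s) (b : 'I_t),
          [/\ tintegrable (fun th => q0 (F th a b)), tintegrable (fun th => q1 (F th a b)),
              tintegrable (fun th => q2 (F th a b)) & tintegrable (fun th => q3 (F th a b))])
  (n : 'I_d -> nat) :
  blockPhi (ToepL n F) = Toep n (GL Z W) /\ blockPhi (ToepR n F) = Toep n (GR Z W).
Proof.
split; apply/funext => al; apply/funext => be; rewrite /blockPhi /ToepL /ToepR /Toep.
- exact: Phi_FcoefL hF _.
- exact: Phi_FcoefR hF _.
Qed.
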